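(* Let $G$ be a square and let $H$ be any graph. Then the Cartesian product $G\,\Box\, H$ is a square.
   Context: $G\,\Box\,H$ has vertex set $V(G)\times V(H)$, with $(g,h)$ adjacent to $(g',h')$ iff either $g=g'$ and $hh'\in E(H)$, or $h=h'$ and $gg'\in E(G)$. All graphs are finite, simple, with nonempty vertex sets. A partially labeled graph is a graph $K$ together with an injective map $\theta: L\to V(K)$, $L\subseteq\mathbb{N}$, whose image $\theta(L)$ is nonempty and a proper subset of $V(K)$; vertices in $\theta(L)$ are labeled. The square $KK$ is obtained from two disjoint copies of $K$ by identifying each labeled vertex $\theta(\ell)$ of the first copy with $\theta(\ell)$ of the second copy (keeping all edges, merging double edges). A graph is a square if it is isomorphic to $KK$ for some partially labeled graph $K$. *)

(* Defs.v *)
From HB Require Import structures.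
From mathcomp Require Import all_boot finmap.

Set Implicit Arguments.
Unset Strict Implicit.
Unset Printing Implicit Defensive.

Local Open Scope quotient_scope.

Record graph := Graph {
  vert :> finType;
  adj : rel vert;
  adj_sym : symmetric adj;
  adj_irrefl : irreflexive adj;
  vert_gt0 : 0 < #|vert|
}.

Definition isomorphic (G H : graph) : Prop :=
  exists2 f : G -> H, bijective f & forall x y, adj (f x) (f y) = adj x y.

Section CartesianProduct.
Variables G H : graph.

Definition cart_adj (p q : G * H) : bool :=
  ((p.1 == q.1) && adj p.2 q.2) || ((p.2 == q.2) && adj p.1 q.1).

Fact cart_adj_sym : symmetric cart_adj.
Proof.
move=> p q; rewrite /cart_adj (adj_sym p.1) (adj_sym p.2).
by rewrite (eq_sym p.1) (eq_sym p.2).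
Qed.

Fact cart_adj_irrefl : irreflexive cart_adj.
Proof. by move=> p; rewrite /cart_adj !adj_irrefl !andbF. Qed.

Fact cart_gt0 : 0 < #|{: G * H}|.
Proof. by rewrite card_prod muln_gt0 !vert_gt0. Qed.

Definition cart : graph := Graph cart_adj_sym cart_adj_irrefl cart_gt0.

End CartesianProduct.

(* The label set is a finite set of naturals: this is no restriction, since   *)
(* the labelling is injective into a finite vertex set.                       *)
Record plgraph := PLGraph {
  pl_graph :> graph;
  label : {fset nat};
  theta : label -> pl_graph;
  theta_inj : injective theta;
  labeled_neq0 : theta @: [set: label] != set0;
  labeled_proper : theta @: [set: label] \proper [set: pl_graph]
}.

Section Square.
Variable K : plgraph.

(* K + K is the vertex set of the disjoint union of two copies of K.          *)
Definition glue (x y : K + K) : bool :=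
  match x, y with
  | inl u, inl v | inr u, inr v => u == v
  | inl u, inr v | inr u, inl v =>
      [exists l : label K, (u == theta l) && (v == theta l)]
  end.

Fact glue_refl : reflexive glue.
Proof. by case=> u /=. Qed.

Fact glue_sym : symmetric glue.
Proof.
by case=> u [] v /=; rewrite 1?eq_sym //; apply: eq_existsb => l; rewrite andbC.
Qed.

Fact glue_trans : transitive glue.
Proof.
case=> u [] v [] w //=; do ?[by move=> /eqP-> | by move=> + /eqP<-];
by move=> /existsP[l /andP[/eqP-> /eqP->]] /existsP[m /andP[/eqP-> /eqP->]].
Qed.

Canonical glue_equiv := EquivRel glue glue_refl glue_sym glue_trans.

Definition sq_vert := {eq_quot glue_equiv}.
HB.instance Definition _ := Choice.on sq_vert.
HB.instance Definition _ := EqQuotient.on sq_vert.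
HB.instance Definition _ : isCountable sq_vert :=
  CanIsCountable (@reprK _ sq_vert).
HB.instance Definition _ : isFinite sq_vert := CanIsFinite (@reprK _ sq_vert).

Definition sum_adj (x y : K + K) : bool :=
  match x, y with
  | inl u, inl v | inr u, inr v => adj u v
  | _, _ => false
  end.

Definition sq_adj (a b : sq_vert) : bool :=
  [exists x, exists y, [&& \pi_sq_vert x == a, \pi_sq_vert y == b & sum_adj x y]].

Fact sq_adj_sym : symmetric sq_adj.
Proof.
have sumC x y : sum_adj x y = sum_adj y x.
  by case: x y => u [] v //=; rewrite adj_sym.
have sub a b : sq_adj a b -> sq_adj b a.
  case/existsP=> x /existsP[y /and3P[xa yb xy]].
  by apply/existsP; exists y; apply/existsP; exists x; rewrite xa yb sumC.
by move=> a b; apply/idP/idP => /sub.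
Qed.

Fact sq_adj_irrefl : irreflexive sq_adj.
Proof.
move=> a; apply/negbTE/negP => /existsP[x /existsP[y /and3P[/eqP<- + xy]]].
rewrite eqmodE /= => yx.
by case: x y xy yx => u [] v //= + /eqP e; rewrite e adj_irrefl.
Qed.

Fact sq_gt0 : 0 < #|{: sq_vert}|.
Proof.
have /card_gt0P[u _] := vert_gt0 K.
by apply/card_gt0P; exists (\pi_sq_vert (inl u)).
Qed.

Definition square : graph := Graph sq_adj_sym sq_adj_irrefl sq_gt0.

End Square.

Definition is_square (G : graph) : Prop :=
  exists K : plgraph, isomorphic G (square K).

(* Main.v *)
(* A graph is a square exactly when it is covered by two copies of a graph K,  *)
(* meeting precisely in the image of a nonempty proper set S of vertices, with *)
(* no edge between the two copies outside S. If K and S describe G in this     *)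
(* way, then K \Box H and S x V(H) describe G \Box H.                          *)
Require Import Defs.
From mathcomp Require Import all_boot finmap.

Set Implicit Arguments.
Unset Strict Implicit.
Unset Printing Implicit Defensive.

Local Open Scope quotient_scope.

(** [doubling] describes $KK$ by equalities and adjacencies alone; [is_squareP] lets it replace the
    quotient. It passes to products ([doubling_cart]) because an edge of $G\,\Box\,H$ either fixes
    the $G$-coordinate, hence stays within a copy, or projects to an edge of $G$, which lies within
    a copy. *)

(* [f false] and [f true] are the embeddings of the two copies of K into G.    *)
Record doubling (K : graph) (S : {set K}) (G : graph) (f : bool -> K -> G) :
    Prop := Doubling {
  doubling_eq : forall b c x y,
    (f b x == f c y) = (x == y) && ((b == c) || (x \in S));
  doubling_adj : forall b c x y,
    adj (f b x) (f c y) = adj x y && [|| b == c, x \in S | y \in S];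
  doubling_surj : forall v, exists p : bool * K, f p.1 p.2 = v
}.

(** The fields determine equality and adjacency of the points [f b x] from [b], [x] and [S] alone,
    so sending [f b x] to [f' b x] is well defined and an isomorphism. *)
Lemma doubling_unique (K : graph) (S : {set K}) (G G' : graph)
    (f : bool -> K -> G) (f' : bool -> K -> G') :
  doubling S f -> doubling S f' -> isomorphic G G'.
Proof.
move=> [feq fadj fsurj] [feq' fadj' fsurj'].
have [s sK] := fin_all_exists fsurj.
have [s' sK'] := fin_all_exists fsurj'.
exists (fun v => f' (s v).1 (s v).2).
  exists (fun v => f (s' v).1 (s' v).2) => v; apply/eqP.
    by rewrite -[X in _ == X]sK feq -feq' sK'.
  by rewrite -[X in _ == X]sK' feq' -feq sK.
by move=> v w; rewrite fadj' -fadj !sK.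
Qed.

Lemma doubling_iso (K : graph) (S : {set K}) (G G' : graph)
    (f : bool -> K -> G) (g : G -> G') :
  bijective g -> (forall x y, adj (g x) (g y) = adj x y) ->
  doubling S f -> doubling S (fun b x => g (f b x)).
Proof.
move=> [g' gK g'K] gadj [feq fadj fsurj]; split=> [b c x y|b c x y|v].
- by rewrite (can_eq gK) feq.
- by rewrite gadj fadj.
- by have [p pv] := fsurj (g' v); exists p; rewrite pv g'K.
Qed.

Definition labeled (K : plgraph) : {set K} := @theta K @: [set: label K].

Definition copy (K : plgraph) (b : bool) (u : K) : K + K :=
  if b then inr u else inl u.

Lemma glue_copy (K : plgraph) b c (u v : K) :
  glue (copy b u) (copy c v) = (u == v) && ((b == c) || (u \in labeled K)).
Proof.
have ex : [exists l : label K, (u == theta l) && (v == theta l)] =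
    (u == v) && (u \in labeled K).
  apply/existsP/andP=> [[l /andP[/eqP-> /eqP->]]|[/eqP<- /imsetP[l _ ->]]].
    by rewrite eqxx imset_f ?inE.
  by exists l; rewrite eqxx.
by case: b c => [] [] /=; rewrite ?andbT ?ex.
Qed.

Lemma doubling_square (K : plgraph) :
  doubling (labeled K)
    (fun b u => \pi_(sq_vert K) (copy b u) : square K).
Proof.
have pi_eq b c (u v : K) :
    (\pi_(sq_vert K) (copy b u) == \pi_(sq_vert K) (copy c v)) =
    (u == v) && ((b == c) || (u \in labeled K)).
  by rewrite eqmodE /= glue_copy.
have copyP (x : K + K) : exists p, x = copy p.1 p.2.
  by case: x => u; [exists (false, u) | exists (true, u)].
split=> [b c u v|b c u v|a]; first exact: pi_eq.
- apply/existsP/andP=> [[x /existsP[y /and3P[]]]|[uv]].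
    have [[b' u'] ->] := copyP x; have [[c' v'] ->] := copyP y.
    rewrite !pi_eq /= => /andP[/eqP-> bu] /andP[/eqP-> cv] xy.
    have [ebc uv] : b' = c' /\ adj u v by case: (b') (c') xy => [] [].
    split=> //; move: bu cv; rewrite ebc.
    by case: (u \in _); case: (v \in _); rewrite ?orbT ?orbF // => /eqP-> /eqP->.
  (* An edge arises as soon as both endpoints have representatives in a common copy [d]; a vertex of
     the labeled set can be moved to the other endpoint's copy. *)
  have edge d : [|| d == b | u \in labeled K] -> [|| d == c | v \in labeled K] ->
      exists x, [exists y, [&& \pi_(sq_vert K) x == \pi_(sq_vert K) (copy b u),
        \pi_(sq_vert K) y == \pi_(sq_vert K) (copy c v) & sum_adj x y]].
    move=> db dc; exists (copy d u); apply/existsP; exists (copy d v).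
    by rewrite !pi_eq !eqxx db dc /=; case: (d).
  case/or3P=> [/eqP bc|uS|vS].
  + by apply: (edge c); rewrite ?bc eqxx.
  + by apply: (edge c); rewrite ?uS ?eqxx ?orbT.
  + by apply: (edge b); rewrite ?vS ?eqxx ?orbT.
- by have [p pa] := copyP (repr a); exists p; rewrite -pa reprK.
Qed.

Lemma set_labeling (T : finType) (S : {set T}) : S != set0 ->
  exists (L : {fset nat}) (th : L -> T), injective th /\ th @: [set: L] = S.
Proof.
move=> /set0Pn[x0 _].
pose L : {fset nat} := [fset i in iota 0 #|S|]%fset.
have ltL (l : L) : fsval l < #|S|.
  by have := fsvalP l; rewrite !inE /= mem_iota.
(* Labels are the positions in [enum S]; [x0] is only the default of [nth]. *)
pose th (l : L) : T := nth x0 (enum S) (fsval l).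
exists L, th; split.
  move=> l m /eqP; rewrite nth_uniq -?cardE ?ltL ?enum_uniq //.
  by move=> /eqP/val_inj.
apply/setP=> x; apply/imsetP/idP=> [[l _ ->]|xS].
  by rewrite -mem_enum mem_nth // -cardE.
have iL : index x (enum S) \in L.
  by rewrite !inE /= mem_iota add0n cardE index_mem mem_enum.
by exists [` iL]%fset; rewrite ?inE // /th nth_index ?mem_enum.
Qed.

Lemma is_squareP (G : graph) :
  is_square G <-> exists (K : graph) (S : {set K}) (f : bool -> K -> G),
    [/\ S != set0, S \proper [set: K] & doubling S f].
Proof.
split=> [[K [g [g' gK g'K] gadj]]|[K [S [f [S0 SP fS]]]]].
  exists K, (labeled K).
  exists (fun b u => g' (\pi_(sq_vert K) (copy b u) : square K)).
  split; [exact: labeled_neq0 | exact: labeled_proper |].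
  apply: doubling_iso (doubling_square K); first by exists g.
  by move=> x y; rewrite -gadj !g'K.
have [L [th [th_inj imth]]] := set_labeling S0.
(* With [S] written as the image of [th], it is [labeled] of the new [PLGraph] by conversion. *)
rewrite -imth in S0 SP fS; exists (PLGraph th_inj S0 SP).
exact: doubling_unique fS (doubling_square (PLGraph th_inj S0 SP)).
Qed.

Lemma doubling_cart (K : graph) (S : {set K}) (G H : graph)
    (f : bool -> K -> G) :
  doubling S f ->
  @doubling (cart K H) (setX S [set: H]) (cart G H)
    (fun b p => (f b p.1, p.2)).
Proof.
move=> [feq fadj fsurj]; split=> [b c [x h] [y k]|b c [x h] [y k]|[v h]].
- by rewrite !xpair_eqE /= feq !inE andbT andbAC.
- rewrite /= /cart_adj /= feq fadj !inE !andbT.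
  (* For [x = y] only edges of [H] survive and the two membership tests coincide; otherwise only
     edges of [G] do. *)
  case: eqP => [->|_]; last by rewrite /= andbA.
  by rewrite adj_irrefl /= andbF !orbF orbb andbC.
- by have [[b x] /= <-] := fsurj v; exists (b, (x, h)).
Qed.

Theorem theorem5p2 (G H : graph) (hG : is_square G) : is_square (cart G H).
Proof.
have /is_squareP[K [S [f [/set0Pn[x xS] /properP[_ [y _ yS]] fS]]]] := hG.
(* Pairing with [h] carries vertices inside and outside [S] over to the product. *)
have /card_gt0P[h _] := vert_gt0 H.
apply/is_squareP; exists (cart K H), (setX S [set: H]).
exists (fun b p => (f b p.1, p.2)); split; last exact: doubling_cart.
  by apply/set0Pn; exists (x, h); rewrite !inE xS.
apply/properP; split; first exact: subsetT.
by exists (y, h); rewrite !inE // (negbTE yS).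
Qed.
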